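(* Let $X$ be a topological group and $G$ a locally compact subgroup of $X$. Then the action of $G$ on $X$ given by $g*x = xg^{-1}$, for $g\in G$ and $x\in X$, is proper in the sense of Palais.
   Context: All topological groups are assumed Hausdorff. For a topological group $G$, a $G$-space is a completely regular Hausdorff space $X$ with a fixed continuous action of $G$ on it. For subsets $U,V\subset X$ put $\langle U,V\rangle=\{g\in G \mid gU\cap V\neq\emptyset\}$ (here $gU$ denotes the image of $U$ under the action of $g$). Subsets $U,V$ are thin relative to each other if $\langle U,V\rangle$ has compact closure in $G$. A subset $V\subset X$ is small (or $G$-small) if every point of $X$ has a neighborhood $U$ such that $\langle U,V\rangle$ has compact closure in $G$. A $G$-space $X$ is proper (in the sense of Palais) if every point of $X$ has a small neighborhood. *)

(* Defs.v *)
From HB Require Import structures.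
From mathcomp Require Import all_boot all_order all_algebra.
From mathcomp Require Import all_classical all_reals all_analysis.

Set Implicit Arguments.
Unset Strict Implicit.
Unset Printing Implicit Defensive.

Local Open Scope classical_set_scope.
Local Open Scope group_scope.

(* Multiplicative, possibly non-commutative counterpart of the library's       *)
(* additive [TopologicalZmodule]. As there, separation is not part of the      *)
(* structure: [hausdorff_space] is a separate hypothesis.                      *)
HB.mixin Record isTopologicalGroup X & Topological X & Group X := {
  mulg_continuous : continuous (fun p : X * X => p.1 * p.2) ;
  invg_continuous : continuous (fun x : X => x^-1)
}.

#[short(type="topologicalGroupType")]
HB.structure Definition TopologicalGroup :=
  {X of Topological X & Group X & isTopologicalGroup X}.

(* Alias of [set_type [set` G]] (hence with the induced topology), on which the *)
(* group structure can be declared since [G] bundles its closure properties.   *)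
(* Topological notions on a subgroup are to be taken on this type: for example *)
(* the library's [locally_compact A], for A a proper subset of X, only asks    *)
(* for compact neighborhoods in X, not in A.                                   *)
Definition subgroup_type (X : topologicalGroupType) (G : groupClosed X) : Type :=
  set_type [set` G].

Section subgroup_type.
Context (X : topologicalGroupType) (G : groupClosed X).

HB.instance Definition _ := Topological.on (subgroup_type G).
HB.instance Definition _ := SubChoice.on (subgroup_type G).

Lemma subgroup_type_closed : group_closed (mem [set` G]).
Proof.
split; first by rewrite in_setE; exact: gpred1.
by move=> x y; rewrite !in_setE /= => Gx Gy; exact: gpredF.
Qed.

HB.instance Definition _ :=
  SubChoice_isSubGroup.Build X _ (subgroup_type G) subgroup_type_closed.

Lemma continuous_subgroup_val : continuous (val : subgroup_type G -> X).
Proof. exact: (@initial_continuous (subgroup_type G) X set_val). Qed.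

Lemma continuous_to_subgroup (T : topologicalType) (f : T -> subgroup_type G) :
  continuous (fun t => val (f t)) -> continuous f.
Proof.
move=> /continuousP cf; apply/continuousP => A [B oB <-].
exact: (cf B oB).
Qed.

Let subgroup_mulg_continuous :
  continuous (fun p : subgroup_type G * subgroup_type G => p.1 * p.2).
Proof.
apply: continuous_to_subgroup => p.
apply: (@continuous2_cvg _ _ _ _ _ _ (fun p => val p.1) (fun p => val p.2)
  (fun x y : X => x * y) (val p.1) (val p.2)).
- exact: (@mulg_continuous X (val p.1, val p.2)).
- by apply: continuous_cvg; [exact: continuous_subgroup_val|exact: cvg_fst].
- by apply: continuous_cvg; [exact: continuous_subgroup_val|exact: cvg_snd].
Qed.

Let subgroup_invg_continuous : continuous (fun x : subgroup_type G => x^-1).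
Proof.
apply: continuous_to_subgroup => x.
apply: (@continuous_cvg _ _ _ (nbhs x) _ val (fun y : X => y^-1)).
  exact: (@invg_continuous X (val x)).
exact: continuous_subgroup_val.
Qed.

HB.instance Definition _ := isTopologicalGroup.Build (subgroup_type G)
  subgroup_mulg_continuous subgroup_invg_continuous.

End subgroup_type.

Section palais.
Context (G : topologicalGroupType) (X : topologicalType) (act : G -> X -> X).

Definition G_space : Prop :=
  [/\ hausdorff_space X /\ completely_regular_space X,
      forall x, act 1 x = x,
      forall g h x, act (g * h) x = act g (act h x) &
      continuous (fun p : G * X => act p.1 p.2)].

(* <U, V> in Palais' notation. *)
Definition transporter (U V : set X) : set G :=
  [set g | (act g @` U) `&` V !=set0].

Definition thin (U V : set X) : Prop := compact (closure (transporter U V)).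

Definition small (V : set X) : Prop :=
  forall x : X, exists2 U, nbhs x U & thin U V.

Definition palais_proper : Prop :=
  G_space /\ forall x : X, exists2 V, nbhs x V & small V.

End palais.

(* Main.v *)
(** Complete regularity of [X] comes from its left uniformity. For
    properness, let [K] be a compact neighborhood of 1 in [G], containing
    [W `&` G] for some neighborhood [W] of 1 in [X]. The transporter from [y M]
    to [x N] is the trace on [G] of [N^-1 z M], with [z = x^-1 y]. If [g] and
    [h] lie in it, then [g h^-1] is in [N^-1 (z M M^-1 z^-1) N], which is
    contained in [W] when [N] is small and then [M] is small depending on [z];
    so, unless it is empty, the transporter is contained in the translate
    [K h]. *)

Require Import Defs.
From HB Require Import structures.
From mathcomp Require Import all_boot all_order all_algebra.
From mathcomp Require Import all_classical all_reals all_analysis.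

Local Open Scope classical_set_scope.
Local Open Scope group_scope.

Section topological_group.
Context {X : topologicalGroupType}.
Implicit Types (x z : X) (U : set X).

Lemma cvgMg (T : Type) (F : set_system T) (FF : Filter F) (f g : T -> X) x z :
  f @ F --> x -> g @ F --> z -> (fun t => f t * g t) @ F --> x * z.
Proof.
move=> fx gz.
exact: (@continuous2_cvg _ _ _ _ _ _ f g (fun x y : X => x * y) x z
  (@mulg_continuous X (x, z)) fx gz).
Qed.

Lemma cvgVg (T : Type) (F : set_system T) (FF : Filter F) (f : T -> X) x :
  f @ F --> x -> (fun t => (f t)^-1) @ F --> x^-1.
Proof. by move=> fx; exact: (continuous_cvg _ (@invg_continuous X x) fx). Qed.

Lemma nbhs_mulgl x z U : nbhs (x * z) U -> nbhs z (fun u => U (x * u)).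
Proof.
move=> xzU; have : (fun u => x * u) @ z --> x * z.
  by apply: cvgMg; [exact: cvg_cst|exact: cvg_id].
exact.
Qed.

Lemma nbhs_mulVg x U : nbhs 1 U -> nbhs x (fun y => U (x^-1 * y)).
Proof. by move=> U1; apply: nbhs_mulgl; rewrite mulVg. Qed.

Lemma nbhs_conjg z U : nbhs 1 U -> nbhs 1 (fun u => U (z * u * z^-1)).
Proof.
move=> U1; have : (fun u => z * u * z^-1) @ (1 : X) --> z * 1 * z^-1.
  by do ![apply: cvgMg]; [exact: cvg_cst|exact: cvg_id|exact: cvg_cst].
by rewrite mulg1 mulgV; apply.
Qed.

Lemma nbhs1V U : nbhs 1 U -> nbhs 1 (fun u => U u^-1).
Proof.
move=> U1; have : (fun u => u^-1) @ (1 : X) --> (1 : X)^-1.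
  by apply: cvgVg; exact: cvg_id.
by rewrite invg1; apply.
Qed.

Lemma nbhs1_split U : nbhs 1 U ->
  exists2 V, nbhs 1 V & forall u v, V u -> V v -> U (u * v).
Proof.
move=> U1; have := @mulg_continuous X (1, 1) U.
rewrite /= mulg1 => /(_ U1) [[A B] /= [A1 B1] AB].
exists (A `&` B); first exact: filterI.
by move=> u v [Au _] [_ Bv]; exact: (AB (u, v)).
Qed.

Definition left_entourage : set_system (X * X) :=
  filter_from (nbhs 1) (fun U => [set p | U (p.1^-1 * p.2)]).

Lemma left_entourage_filter : Filter left_entourage.
Proof.
apply: filter_from_filter; first by exists setT; exact: filterT.
by move=> U V U1 V1; exists (U `&` V) => //; exact: filterI.
Qed.

Lemma left_entourage_diagonal A : left_entourage A -> diagonal `<=` A.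
Proof.
move=> [U /nbhs_singleton U1 UA] [x y] /= xy; apply: UA => /=.
by rewrite (xy : x = y) mulVg.
Qed.

Lemma left_entourage_inv A : left_entourage A -> left_entourage A^-1%relation.
Proof.
move=> [U U1 UA]; exists (fun u => U u^-1); first exact: nbhs1V.
by move=> [x y] /=; rewrite invgM invgK => Uyx; exact: (UA (y, x)).
Qed.

(** The factorization x^-1 y = (x^-1 z) (z^-1 y) reduces this to splitting a neighborhood of 1. *)
Lemma left_entourage_split A : left_entourage A ->
  exists2 B, left_entourage B & (B \; B `<=` A)%relation.
Proof.
move=> [U /nbhs1_split[V V1 VU] UA].
exists [set p | V (p.1^-1 * p.2)]; first by exists V.
move=> [x y] [z /= Vxz Vzy]; apply: UA => /=.
by have := VU _ _ Vxz Vzy; rewrite mulgA mulgK.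
Qed.

(** The sections at x of the basic entourages are the translates x U of neighborhoods U of 1, and
    left translations are continuous. *)
Lemma nbhs_left_entourage : nbhs = nbhs_ left_entourage.
Proof.
apply/funext => x; rewrite nbhs_E; apply/seteqP; split => A.
  move=> xA; exists [set p | A (x * (p.1^-1 * p.2))].
    by exists (fun u => A (x * u)) => //; apply: nbhs_mulgl; rewrite mulg1.
  by move=> y /xsectionP /=; rewrite mulVKg.
move=> [E [U U1 UE] EA]; apply: filterS (nbhs_mulVg x U U1) => y Uxy.
by apply: EA; apply/xsectionP; exact: UE.
Qed.

End topological_group.

(** An alias carries the left uniformity, so that [X] itself keeps only its topology and group
    structure. *)
Definition left_uniform_type (X : topologicalGroupType) : Type := X.

Section left_uniform_type.
Context (X : topologicalGroupType).

HB.instance Definition _ := Topological.copy (left_uniform_type X) X.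
HB.instance Definition _ := @Nbhs_isUniform.Build (left_uniform_type X)
  (@left_entourage X) (@left_entourage_filter X) (@left_entourage_diagonal X)
  (@left_entourage_inv X) (@left_entourage_split X) (@nbhs_left_entourage X).

End left_uniform_type.

Lemma topological_group_completely_regular (X : topologicalGroupType) :
  completely_regular_space X.
Proof.
move=> x B clB nBx; exists (Uniform.class (left_uniform_type X)).
exists [set p | ~ B (x * (p.1^-1 * p.2))]; split => //.
- exists (fun u => ~ B (x * u)) => //.
  apply: (nbhs_mulgl x 1 (~` B)); rewrite mulg1.
  by apply: open_nbhs_nbhs; split=> //; exact: closed_openC.
- by rewrite -subset0 => -[_ y] [[/= -> By]]; rewrite mulVKg.
- by move=> y A.
Qed.

Lemma nbhs_subgroup_val (X : topologicalGroupType) (G : groupClosed X)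
    (K : set (subgroup_type G)) : nbhs 1 K ->
  exists2 W, nbhs (1 : X) W & forall g : subgroup_type G, W (val g) -> K g.
Proof.
rewrite nbhsE => -[_ [[W oW <-] W1] WK].
by exists W; [exact: open_nbhs_nbhs|move=> g; exact: WK].
Qed.

Lemma precompact_mulgr (G : topologicalGroupType) (K : set G) (h : G) :
  precompact K -> precompact [set g | K (g * h^-1)].
Proof.
move=> [L KL [cptL clL]]; exists [set g | L (g * h^-1)].
  by move=> g; exact: KL.
split; last first.
  apply: (closed_comp _ clL) => g _.
  by apply: cvgMg; [exact: cvg_id|exact: cvg_cst].
(* Closedness came from a preimage; compactness needs the same set as an image, the translate L
   h. *)
suff -> : [set g | L (g * h^-1)] = (fun g => g * h) @` L.
  apply: continuous_compact => //; apply: continuous_subspaceT => g.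
  by apply: cvgMg; [exact: cvg_id|exact: cvg_cst].
apply/seteqP; split=> [g Lg|_ [g Lg <-] /=]; last by rewrite mulgK.
by exists (g * h^-1) => //; rewrite mulgVK.
Qed.

Lemma right_translation_G_space (X : topologicalGroupType) (G : groupClosed X) :
  hausdorff_space X ->
  G_space (fun (g : subgroup_type G) (x : X) => x * (val g)^-1).
Proof.
move=> hausX; split.
- by split => //; exact: topological_group_completely_regular.
- by move=> x; rewrite /= invg1 mulg1.
- by move=> g h x; rewrite /= invgM mulgA.
- move=> p; apply: cvgMg; first exact: cvg_snd.
  apply: cvgVg.
  apply: (@continuous_cvg _ _ _ (nbhs p) _ (fun q => q.1) val p.1).
    exact: continuous_subgroup_val.
  exact: cvg_fst.
Qed.

Theorem theorem1p1 (X : topologicalGroupType) (G : groupClosed X)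
    (hausX : hausdorff_space X)
    (lcG : locally_compact [set: subgroup_type G]) :
  palais_proper (fun (g : subgroup_type G) (x : X) => x * (val g)^-1).
Proof.
split; first exact: right_translation_G_space.
have [K K1 cptK] : exists2 K : set (subgroup_type G), nbhs 1 K & precompact K.
  have [K + cptK] := lcG 1 I; rewrite /within /= => K1; exists K.
    by apply: filterS K1 => g; exact.
  by exists K.
have [W W1 WK] := nbhs_subgroup_val _ _ _ K1.
(* Two splittings, since g h^-1 will be a product of three factors: one in [N1] and two in [N2]. *)
have [N1 /nbhs1_split[N2 N21 N2N1] N1W] := nbhs1_split _ W1.
have N11 : nbhs 1 N1.
  apply: filterS (N21) => u N2u; rewrite -(mulg1 u); apply: N2N1 => //.
  exact: (nbhs_singleton N21).
(* The outer factors are n^-1, required in [N1], and n', required in [N2], with n and n' in [N]. *)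
pose N := (fun u => N1 u^-1) `&` N2.
have N_1 : nbhs 1 N by apply: filterI => //; exact: nbhs1V.
move=> x; exists (fun v => N (x^-1 * v)); first exact: nbhs_mulVg.
move=> y; pose z := x^-1 * y.
(* Products of two points of [M1], conjugated by z, fall in [N2]. Adding the inverse condition in
   [M] lets this apply to m m'^-1. *)
have [M1 /[dup] /nbhs1V M1V M11 M1N] := nbhs1_split _ (nbhs_conjg z N2 N21).
pose M := M1 `&` (fun u => M1 u^-1).
exists (fun u => M (y^-1 * u)); first by apply: nbhs_mulVg; exact: filterI.
(* As precompactness, thinness means having a closed compact superset, a property that passes to
   subsets. *)
rewrite /thin -precompactE; set S := transporter _ _ _.
have SE (g : subgroup_type G) : S g ->
    exists n m, [/\ N n, M m & val g = n^-1 * z * m].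
  (* With v = u g^-1, u = y m and v = x n, one gets g = v^-1 u = n^-1 x^-1 y m. *)
  move=> [_ [[u Mu <-] Nv]]; do 2!eexists; split; [exact: Nv|exact: Mu|].
  by rewrite /z !invgM !invgK -!mulgA mulVKg mulVKg mulVg mulg1.
have [S0|/set0P[h Sh]] := eqVneq S set0.
  by rewrite S0 precompactE closure0; exact: compact0.
apply: precompact_subset (precompact_mulgr _ K h cptK) => g Sg /=.
apply: WK.
have [n [m [[Nn _] [Mm _] gE]]] := SE g Sg.
have [n' [m' [[_ Nn'] [_ Mm'] hE]]] := SE h Sh.
rewrite /= gE hE.
have -> : n^-1 * z * m * (n'^-1 * z * m')^-1 =
    n^-1 * ((z * (m * m'^-1) * z^-1) * n').
  by rewrite !invgM !invgK !mulgA.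
by apply: N1W => //; apply: N2N1 => //; exact: M1N.
Qed.
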